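(* Let $\mathcal{A}=(S,\Sigma,\delta_{\mathcal{A}},I,F)$ be a may/must alternating automaton (MMAA) whose set $F$ of co-Büchi accepting states is exactly the set of all its may-states. Let $\mathcal{T}=(M,\Sigma,\delta_{\mathcal{T}},m_I)$ be the semiautomaton of macrostates for $\mathcal{A}$ and, for each $Z\subseteq S$, let $\mathcal{GR}_Z=(\delta_{\mathcal{T}}\smallsetminus \mathrm{AT}_Z,\{\mathrm{AT}_Z^f\}_{f\in F\cap Z})$ be the generalized Rabin pair defined in the context. Then the transition-based generalized deterministic Rabin automaton $\mathcal{G}=(M,\Sigma,\delta_{\mathcal{T}},m_I,\{\mathcal{GR}_Z\mid Z\subseteq S\})$ satisfies $L(\mathcal{G})=L(\mathcal{A})$.
   Context: Alphabet and words. An alphabet is a finite set $\Sigma=2^{AP'}$ with $AP'$ a finite set of atomic propositions; words are elements $w=w_0w_1\ldots\in\Sigma^\omega$. VWAA. A very weak alternating co-Büchi automaton (VWAA) is a tuple $(S,\Sigma,\delta,I,F)$ with $S$ a finite set of states (subsets $c\subseteq S$ are called configurations), $\delta\subseteq S\times\Sigma\times 2^S$, $I\subseteq 2^S$ a non-empty set of initial configurations, $F\subseteq S$ the co-Büchi accepting states, such that there is a partial order on $S$ where for every $(s,\alpha,c)\in\delta$ all states of $c$ are lower than or equal to $s$. A transition $(s,\alpha,c)$ is looping if $s\in c$, and a selfloop if $c=\{s\}$. Multitransitions and runs. A multitransition $T$ with label $\alpha$ is a set of transitions, all labelled $\alpha$, with pairwise different source states (the empty set is a multitransition with any label). $\mathrm{dom}(T)$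 is the set of source states of transitions in $T$; $\mathrm{range}(T)$ is the union of their target configurations. The multitransition relation is $\Delta=\{(\mathrm{dom}(T),\alpha,\mathrm{range}(T))\mid T \text{ a multitransition with label }\alpha\}\subseteq 2^S\times\Sigma\times 2^S$. A run over $w$ is an infinite sequence $\rho=T_0T_1\ldots$ of multitransitions with $\mathrm{dom}(T_0)\in I$, $T_i$ labelled by $w_i$, and $\mathrm{range}(T_i)=\mathrm{dom}(T_{i+1})$ for all $i\ge0$. The run is accepting if it has no suffix such that, for some $f\in F$, every multitransition of the suffix contains a looping transition from $f$. $L(\mathcal{A})$ is the set of words over which $\mathcal{A}$ has an accepting run. MMAA. A may/must alternating automaton (MMAA) is a VWAA in which each state is of one of the following kinds: may-state (has a selfloop $(s,\alpha,\{s\})$ for each $\alpha\in\Sigma$); must-state (every transition of the state is looping); loopless state (has no looping transitions and no predecessors, i.e. does not occur in the target configuration of any transition). For $Z\subseteq S$, $\mathrm{must}(Z)$ is the set of must-states in $Z$. Semiautomata and TGDRA. A semiautomaton $(M,\Sigma,\delta,m_I)$ has a finite set of states $M$, an initial state $m_I$ and a deterministic transition relation $\delta\subseteq M\times\Sigma\times M$ (at most one successor per state and letter). Its run over $w$ is the sequence $\sigma(w)=(m_0,w_0,m_1)(m_1,w_1,m_2)\ldots\in\delta^\omega$ with $m_0=m_I$; $\mathit{Inf}_t(\sigma)$ is the set of transitions occurring infinitely often in $\sigma$. A transition-based generalized deterministic Rabin automaton (TGDRA) is a semiautomaton together with a finite set of generalized Rabin pairs $(K,\{L_j\}_{j\in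 J})$, where $K\subseteq\delta$ and each $L_j\subseteq\delta$. A run $\sigma$ satisfies such a pair if $\mathit{Inf}_t(\sigma)\cap K=\emptyset$ and $\mathit{Inf}_t(\sigma)\cap L_j\ne\emptyset$ for each $j\in J$. A run is accepting if it satisfies some pair, and the language is the set of words $w$ such that $\sigma(w)$ is accepting. The semiautomaton $\mathcal{T}$ for $\mathcal{A}$. Let $\Delta_{\mathcal{A}}$ be the multitransition relation of $\mathcal{A}$. $\mathcal{T}=(M,\Sigma,\delta_{\mathcal{T}},m_I)$ where $m_I=I$; for a macrostate $m_1\subseteq 2^S$ and $\alpha\in\Sigma$ the unique $\alpha$-transition is $(m_1,\alpha,m_2)$ with $m_2=\bigcup_{c\in m_1}\{c'\mid (c,\alpha,c')\in\Delta_{\mathcal{A}}\}$; and $M\subseteq 2^{2^S}$ is the set of macrostates reachable from $m_I$. Acceptance. For $Z\subseteq S$: $\mathrm{AC}_Z=\{c\subseteq Z\mid \mathrm{must}(c)=\mathrm{must}(Z)\}$; $\mathrm{AT}_Z=\{(m_1,\alpha,m_2)\in\delta_{\mathcal{T}}\mid \exists c_1\in\mathrm{AC}_Z,\ \exists c_2\in m_2\cap\mathrm{AC}_Z:\ (c_1,\alpha,c_2)\in\Delta_{\mathcal{A}}\}$; for $f\in F\cap Z$, $\mathrm{AT}_Z^f=\{(m_1,\alpha,m_2)\in\mathrm{AT}_Z\mid \exists (f,\alpha,c)\in\delta_{\mathcal{A}}:\ f\notin c,\ c\subseteq Z\}$. *)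

(* Defs.v *)
From mathcomp Require Import all_boot.

Set Implicit Arguments.
Unset Strict Implicit.
Unset Printing Implicit Defensive.

Definition word (Sigma : Type) := nat -> Sigma.

(* [(s, a, x)]: source, letter, target.  The target is a configuration for
   alternating automata and a state for semiautomata. *)
Definition transition (P L X : Type) := (P * L * X)%type.
Definition src (P L X : Type) (t : transition P L X) : P := t.1.1.
Definition lbl (P L X : Type) (t : transition P L X) : L := t.1.2.
Definition tgt (P L X : Type) (t : transition P L X) : X := t.2.

(* [vw_le] is existentially quantified: the order is not part of the automaton. *)
Record vwaa (S Sigma : finType) := VWAA {
  trans : {set transition S Sigma {set S}};
  init : {set {set S}};
  final : {set S};
  init_neq0 : init != set0;
  very_weak : exists vw_le : rel S,
    [/\ reflexive vw_le, antisymmetric vw_le, transitive vw_le &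
        forall s a (c : {set S}), (s, a, c) \in trans ->
          forall x, x \in c -> vw_le x s]
}.

Section Alternating.
Variables S Sigma : finType.
Implicit Types (A : vwaa S Sigma) (t : transition S Sigma {set S}).
Implicit Types (T : {set transition S Sigma {set S}}).

Definition looping t := src t \in tgt t.

Definition multitransition A (a : Sigma) T :=
  [&& T \subset trans A,
      [forall t in T, lbl t == a] &
      [forall t in T, forall u in T, (src t == src u) ==> (t == u)]].

Definition mdom T : {set S} := [set src t | t in T].
Definition mrange T : {set S} := \bigcup_(t in T) tgt t.

Definition Delta A : {set transition {set S} Sigma {set S}} :=
  [set x : transition {set S} Sigma {set S} |
     [exists T : {set transition S Sigma {set S}},
        multitransition A (lbl x) T && (x == (mdom T, lbl x, mrange T))]].

Definition run A (w : word Sigma)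
    (rho : nat -> {set transition S Sigma {set S}}) : Prop :=
  [/\ mdom (rho 0) \in init A,
      forall i, multitransition A (w i) (rho i) &
      forall i, mrange (rho i) = mdom (rho i.+1)].

Definition accepting_run A
    (rho : nat -> {set transition S Sigma {set S}}) : Prop :=
  ~ exists k f, f \in final A /\
      forall i, k <= i -> exists t, [/\ t \in rho i, src t = f & looping t].

Definition vwaa_lang A (w : word Sigma) : Prop :=
  exists rho, run A w rho /\ accepting_run A rho.

Definition may_state A (s : S) :=
  [forall a : Sigma, (s, a, [set s]) \in trans A].
Definition must_state A (s : S) :=
  [forall t in trans A, (src t == s) ==> looping t].
Definition loopless_state A (s : S) :=
  [forall t in trans A, ((src t == s) ==> ~~ looping t) && (s \notin tgt t)].

Definition mmaa A : Prop :=
  forall s, [|| may_state A s, must_state A s | loopless_state A s].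

Definition must A (Z : {set S}) : {set S} := [set s in Z | must_state A s].

End Alternating.

(* The set of states is a subset [sa_states] of an ambient finite type [X]. *)
Record semiautomaton (X Sigma : finType) := Semiautomaton {
  sa_states : {set X};
  sa_trans : {set transition X Sigma X};
  sa_init : X;
  sa_init_state : sa_init \in sa_states;
  sa_trans_states : forall t, t \in sa_trans ->
    (src t \in sa_states) && (tgt t \in sa_states);
  sa_deterministic : forall m a m1 m2,
    (m, a, m1) \in sa_trans -> (m, a, m2) \in sa_trans -> m1 = m2
}.

(* The pair (K, {L_j}_(j in J)); only the set of the L_j matters for
   satisfaction, so the family is represented by the set of its members. *)
Definition grabin_pair (X Sigma : finType) : finType :=
  ({set transition X Sigma X} * {set {set transition X Sigma X}})%type.

Record tgdra (X Sigma : finType) := TGDRA {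
  semi : semiautomaton X Sigma;
  gr_pairs : {set grabin_pair X Sigma};
  gr_pairs_sub : forall p, p \in gr_pairs ->
    p.1 \subset sa_trans semi /\
    forall L, L \in p.2 -> L \subset sa_trans semi
}.

Section Rabin.
Variables X Sigma : finType.
Implicit Types (sigma : nat -> transition X Sigma X).

(* By determinism there is at most one such [sigma] for a given word. *)
Definition sa_run (B : semiautomaton X Sigma) (w : word Sigma) sigma : Prop :=
  [/\ src (sigma 0) = sa_init B,
      forall i, sigma i \in sa_trans B,
      forall i, lbl (sigma i) = w i &
      forall i, tgt (sigma i) = src (sigma i.+1)].

Definition Inf_t sigma (t : transition X Sigma X) : Prop :=
  forall n, exists2 i, n <= i & sigma i = t.

Definition satisfies_pair sigma (p : grabin_pair X Sigma) : Prop :=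
  (~ exists t, Inf_t sigma t /\ t \in p.1) /\
  (forall L, L \in p.2 -> exists t, Inf_t sigma t /\ t \in L).

Definition tgdra_lang (G : tgdra X Sigma) (w : word Sigma) : Prop :=
  exists sigma, sa_run (semi G) w sigma /\
    exists2 p, p \in gr_pairs G & satisfies_pair sigma p.

End Rabin.

Section Macro.
Variables S Sigma : finType.
Variable A : vwaa S Sigma.

Definition macro_succ (m : {set {set S}}) (a : Sigma) : {set {set S}} :=
  \bigcup_(c in m) [set c' | (c, a, c') \in Delta A].

Definition macro_states : {set {set {set S}}} :=
  [set m | connect [rel m1 m2 | [exists a, m2 == macro_succ m1 a]] (init A) m].

Definition macro_trans : {set transition {set {set S}} Sigma {set {set S}}} :=
  [set t : transition {set {set S}} Sigma {set {set S}} |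
     (src t \in macro_states) && (tgt t == macro_succ (src t) (lbl t))].

Fact macro_init_state : init A \in macro_states.
Proof. by rewrite inE connect0. Qed.

Fact macro_trans_states t : t \in macro_trans ->
  (src t \in macro_states) && (tgt t \in macro_states).
Proof.
rewrite inE => /andP[ms /eqP->]; rewrite ms /=; move: ms; rewrite !inE => ms.
apply: connect_trans ms (connect1 _); apply/existsP; by exists (lbl t).
Qed.

Fact macro_deterministic m a m1 m2 :
  (m, a, m1) \in macro_trans -> (m, a, m2) \in macro_trans -> m1 = m2.
Proof. by rewrite !inE => /andP[_ /eqP/= ->] /andP[_ /eqP/= ->]. Qed.

Definition macro_semiautomaton : semiautomaton {set {set S}} Sigma :=
  Semiautomaton macro_init_state macro_trans_states macro_deterministic.

Definition AC (Z : {set S}) : {set {set S}} :=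
  [set c : {set S} | (c \subset Z) && (must A c == must A Z)].

(* [c1] is not required to belong to the source macrostate. *)
Definition AT (Z : {set S}) :
    {set transition {set {set S}} Sigma {set {set S}}} :=
  [set t in macro_trans |
     [exists c1 in AC Z, exists c2 in tgt t :&: AC Z,
        (c1, lbl t, c2) \in Delta A]].

Definition ATf (Z : {set S}) (f : S) :
    {set transition {set {set S}} Sigma {set {set S}}} :=
  [set t in AT Z |
     [exists c : {set S},
        [&& (f, lbl t, c) \in trans A, f \notin c & c \subset Z]]].

Definition GR (Z : {set S}) : grabin_pair {set {set S}} Sigma :=
  (macro_trans :\: AT Z, [set ATf Z f | f in final A :&: Z]).

Definition GR_pairs : {set grabin_pair {set {set S}} Sigma} :=
  [set GR Z | Z : {set S}].

Fact GR_pairs_sub p : p \in GR_pairs ->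
  p.1 \subset macro_trans /\ forall L, L \in p.2 -> L \subset macro_trans.
Proof.
case/imsetP=> Z _ ->; split=> [|L /imsetP[f _ ->]]; first exact: subsetDl.
by apply/subsetP=> t; rewrite inE => /andP[]; rewrite inE => /andP[].
Qed.

Definition macro_tgdra : tgdra {set {set S}} Sigma :=
  @TGDRA _ _ macro_semiautomaton GR_pairs GR_pairs_sub.

End Macro.

(* Main.v *)
From mathcomp Require Import all_boot.
From Stdlib Require Import Classical.
Require Import Defs.

(** An accepting run of [A] is matched with the pair of the set [Z] of states
    it visits infinitely often: must-states are never left, so almost all
    configurations of the run lie in [AC Z], and acceptance forces every
    [f] in [final A :&: Z] to take infinitely many transitions that leave [f].
    Conversely, if the macrostate run satisfies the pair of [Z], a reachable
    configuration in [AC Z] is continued by a strategy depending only on the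
    current state and letter: leave the state inside [Z] whenever possible,
    otherwise use the selfloop of a may-state, otherwise any transition
    inside [Z]; the latter exists for a must-state of [Z], since it
    belongs to every configuration of [AC Z]. *)

Set Implicit Arguments.
Unset Strict Implicit.
Unset Printing Implicit Defensive.

(** * Recurrence over finite types *)

Lemma recurrent_set (X : finType) (P : X -> nat -> bool) :
  exists (Z : {set X}) k,
    (forall x i, k <= i -> P x i -> x \in Z) /\
    (forall x, x \in Z -> forall n, exists2 i, n <= i & P x i).
Proof.
(* The flag [u.1] says whether [P x] recurs; if not, [u.2] bounds its last occurrence. Finiteness
   lets one maximum serve as [k] for all [x]. *)
pose good x (u : bool * nat) :=
  if u.1 then forall n, exists2 i, n <= i & P x i
  else forall i, u.2 <= i -> ~~ P x i.
have [x|u uP] := fin_all_exists (P := good).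
  case: (classic (forall n, exists2 i, n <= i & P x i)) => [inf|].
    by exists (true, 0).
  case/not_all_ex_not=> n fin; exists (false, n) => i /= le_ni.
  by apply/negP=> Pxi; case: fin; exists i.
exists [set x | (u x).1], (\max_x (u x).2); split=> [x i le_i Pxi|x].
  rewrite inE; apply/idPn=> /negPf ux; have := uP x; rewrite /good ux.
  by move/(_ i (leq_trans (leq_bigmax x) le_i)); rewrite Pxi.
by rewrite inE => ux; have := uP x; rewrite /good ux.
Qed.

Section InfinitelyOften.
Variables X Sigma : finType.
Implicit Types (sigma : nat -> transition X Sigma X).
Implicit Types (L K : {set transition X Sigma X}).

(** Pigeonhole: past some index only recurrent transitions are taken, so any later visit to [L]
    exhibits one. *)
Lemma Inf_t_meetP sigma L :
  (exists t, Inf_t sigma t /\ t \in L) <->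
  (forall n, exists2 i, n <= i & sigma i \in L).
Proof.
split=> [[t [inf_t tL]] n|infL].
  by have [i le_ni si] := inf_t n; exists i; rewrite ?si.
have [Z [k [Zev Zinf]]] := recurrent_set (fun t i => sigma i == t).
have [i le_ki siL] := infL k; exists (sigma i); split=> // n.
by have [j le_nj /eqP] := Zinf _ (Zev _ _ le_ki (eqxx _)) n; exists j.
Qed.

Lemma Inf_t_avoidP sigma K :
  (~ exists t, Inf_t sigma t /\ t \in K) <->
  (exists k, forall i, k <= i -> sigma i \notin K).
Proof.
split=> [noK|[k kK] /Inf_t_meetP/(_ k)[i /kK/negPf->] //].
have [k kK] := not_all_ex_not _ _ (fun h => noK ((Inf_t_meetP _ _).2 h)).
by exists k => i le_ki; apply/negP=> siK; apply: kK; exists i.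
Qed.

End InfinitelyOften.

(** * Multitransitions *)

Section Multitransitions.
Variables S Sigma : finType.
Variable A : vwaa S Sigma.
Implicit Types (w : word Sigma) (c d Z : {set S}) (s : S) (a : Sigma).
Implicit Types (T : {set transition S Sigma {set S}}).

Lemma DeltaP a c d :
  reflect (exists T, [/\ multitransition A a T, mdom T = c & mrange T = d])
          ((c, a, d) \in Delta A).
Proof.
rewrite inE; apply: (iffP existsP) => [] [T].
  by case/andP=> mT /eqP[-> ->]; exists T.
by case=> mT <- <-; exists T; rewrite eqxx andbT.
Qed.

Lemma mdomP T s : reflect (exists2 t, t \in T & src t = s) (s \in mdom T).
Proof. by apply: (iffP imsetP) => [] [t]; exists t. Qed.

Lemma multitransition_trans a T s d :
  multitransition A a T -> (exists t, [/\ t \in T, src t = s & tgt t = d]) ->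
  (s, a, d) \in trans A.
Proof.
case/and3P=> /subsetP TA /forall_inP Ta _ [t [tT <- <-]].
by move: (TA _ tT) (Ta _ tT) => + /eqP <-; case: t {tT} => [[]].
Qed.

Lemma must_state_loop s a d :
  must_state A s -> (s, a, d) \in trans A -> s \in d.
Proof. by move/forall_inP=> h /h; rewrite eqxx. Qed.

Lemma may_trans s a : may_state A s -> (s, a, [set s]) \in trans A.
Proof. by move/forallP. Qed.

Lemma must_mem_range a T s :
  multitransition A a T -> must_state A s -> s \in mdom T -> s \in mrange T.
Proof.
move=> mT ms /mdomP[t tT ts]; apply/bigcupP; exists t => //.
by apply: must_state_loop ms _; apply: multitransition_trans mT _; exists t.
Qed.

Lemma mrange_not_loopless a T s :
  multitransition A a T -> s \in mrange T -> ~~ loopless_state A s.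
Proof.
case/and3P=> /subsetP TA _ _ /bigcupP[t tT st]; apply/negP.
by move/forall_inP/(_ t (TA _ tT)); rewrite st andbF.
Qed.

Section Choice.
Variables (c : {set S}) (a : Sigma) (g : S -> {set S}).

Definition choice_mt : {set transition S Sigma {set S}} :=
  [set (s, a, g s) | s in c].

Lemma choice_mt_dom : mdom choice_mt = c.
Proof.
apply/setP=> s; apply/mdomP/idP=> [[_ /imsetP[x xc ->] <-] //|sc].
by exists (s, a, g s) => //; apply: imset_f.
Qed.

Lemma choice_mt_range : mrange choice_mt = \bigcup_(s in c) g s.
Proof.
apply/setP=> x; apply/bigcupP/bigcupP=> [[_ /imsetP[s sc ->] xs]|[s sc xs]].
  by exists s.
by exists (s, a, g s) => //; apply: imset_f.
Qed.

Lemma choice_mtP :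
  (forall s, s \in c -> (s, a, g s) \in trans A) ->
  multitransition A a choice_mt.
Proof.
move=> gA; apply/and3P; split.
- by apply/subsetP=> _ /imsetP[s sc ->]; apply: gA.
- by apply/forall_inP=> _ /imsetP[s _ ->].
apply/forall_inP=> _ /imsetP[s _ ->]; apply/forall_inP=> _ /imsetP[x _ ->].
by apply/implyP; rewrite /src /= => /eqP->.
Qed.

End Choice.

(** * The macrostate run and its relation to runs of [A] *)

Fixpoint macro_run w n : {set {set S}} :=
  if n is n'.+1 then macro_succ A (macro_run w n') (w n') else init A.

Lemma macro_succP (m : {set {set S}}) a d :
  reflect (exists2 c, c \in m & (c, a, d) \in Delta A) (d \in macro_succ A m a).
Proof.
by apply: (iffP bigcupP) => [] [c cm cd]; exists c; move: cd; rewrite ?inE.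
Qed.

Lemma macro_run_state w n : macro_run w n \in macro_states A.
Proof.
elim: n => [|n IHn] /=; first exact: macro_init_state.
pose t := (macro_run w n, w n, macro_succ A (macro_run w n) (w n)).
have /macro_trans_states/andP[] //: t \in macro_trans A.
by rewrite inE IHn /=.
Qed.

Lemma macro_run_trans w n :
  (macro_run w n, w n, macro_run w n.+1) \in macro_trans A.
Proof. by rewrite inE macro_run_state /=. Qed.

Lemma sa_run_macroP w sigma :
  sa_run (macro_semiautomaton A) w sigma <->
  forall i, sigma i = (macro_run w i, w i, macro_run w i.+1).
Proof.
split=> [[s0 sA sw sS] i|sE].
  have sE j : src (sigma j) = macro_run w j.
    elim: j => [|j IHj]; rewrite ?s0 // -sS /= -IHj -sw.
    by have := sA j; rewrite inE => /andP[_ /eqP].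
  by rewrite -!sE -sS -sw; case: (sigma i) => [[]].
by split=> [|i|i|i]; rewrite ?sE //; apply: macro_run_trans.
Qed.

Lemma run_mdom_macro w rho i : run A w rho -> mdom (rho i) \in macro_run w i.
Proof.
case=> r0 rA rS; elim: i => [|i IHi] //=; apply/macro_succP.
by exists (mdom (rho i)) => //; apply/DeltaP; exists (rho i).
Qed.

(** Unfolding membership in a macrostate backwards yields, one multitransition at a time, a finite
    prefix from an initial configuration. *)
Lemma run_extend_left w n rho :
  mdom (rho 0) \in macro_run w n ->
  (forall i, multitransition A (w (n + i)) (rho i)) ->
  (forall i, mrange (rho i) = mdom (rho i.+1)) ->
  exists2 rho', run A w rho' & forall i, rho' (n + i) = rho i.
Proof.
elim: n rho => [|n IHn] rho; first by exists rho.
case/macro_succP=> c cm /DeltaP[T [mT Tc Td]] rA rS.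
have [||[|i]|rho' runr rE] := IHn (fun i => if i is j.+1 then rho j else T).
- by rewrite Tc.
- by case=> [|i]; rewrite ?addn0 // addnS -addSn.
- by [].
- by [].
by exists rho' => // i; rewrite addSnnS rE.
Qed.

(** * The strategy inside [Z] *)

Section Strategy.
Variable Z : {set S}.

(** Leaving is tried first even for may-states, so [s] loops only when no exit inside [Z] exists.
    The default [set0] occurs only if [s] is not a may-state and has no [a]-transition into [Z]. *)
Definition strategy a s : {set S} :=
  if [pick d | [&& (s, a, d) \in trans A, s \notin d & d \subset Z]] is Some d
  then d
  else if may_state A s then [set s]
  else odflt set0 [pick d | ((s, a, d) \in trans A) && (d \subset Z)].

Lemma strategy_leaves a s :
  [exists d, [&& (s, a, d) \in trans A, s \notin d & d \subset Z]] ->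
  s \notin strategy a s.
Proof.
case/existsP=> d dP; rewrite /strategy.
by case: pickP => [e /and3P[]|/(_ d)] //; rewrite dP.
Qed.

Lemma strategyP a s :
  s \in Z ->
  may_state A s \/ (exists2 d, (s, a, d) \in trans A & d \subset Z) ->
  ((s, a, strategy a s) \in trans A) /\ strategy a s \subset Z.
Proof.
move=> sZ sP; rewrite /strategy; case: pickP => [d /and3P[] //|_].
case: ifPn => [mays|/negP nmay]; first by rewrite may_trans ?sub1set.
case: sP => // -[d dA dZ]; case: pickP => [e /andP[] //|/(_ d)].
by rewrite dA dZ.
Qed.

End Strategy.

Lemma AC_trans Z a c1 c2 s :
  c1 \in AC A Z -> c2 \in AC A Z -> (c1, a, c2) \in Delta A ->
  s \in must A Z -> exists2 d, (s, a, d) \in trans A & d \subset Z.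
Proof.
rewrite ![_ \in AC A Z]inE => /andP[_ /eqP c1Z] /andP[c2Z _].
case/DeltaP=> T [mT Tc1 Tc2]; rewrite -c1Z inE -Tc1 => /andP[/mdomP[t tT ts] _].
exists (tgt t); first by apply: multitransition_trans mT _; exists t.
by apply: subset_trans c2Z; rewrite -Tc2; apply: bigcup_sup tT.
Qed.

(** The pair [c1], [c2] only witnesses that must-states of [Z] can move inside [Z]; it need not
    involve [c]. Looping then keeps all these must-states in the next configuration. *)
Lemma AC_strategy Z a c :
  mmaa A -> (exists c1 c2,
    [/\ c1 \in AC A Z, c2 \in AC A Z & (c1, a, c2) \in Delta A]) ->
  c \in AC A Z -> (forall s, s \in c -> ~~ loopless_state A s) ->
  (forall s, s \in c -> (s, a, strategy Z a s) \in trans A) /\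
  \bigcup_(s in c) strategy Z a s \in AC A Z.
Proof.
move=> mmA [c1 [c2 [c1Z c2Z D12]]]; rewrite inE => /andP[cZ /eqP mustc] cll.
have sP s : s \in c ->
    ((s, a, strategy Z a s) \in trans A) /\ strategy Z a s \subset Z.
  move=> sc; have sZ := subsetP cZ s sc; apply: strategyP => //.
  have /or3P[mays|musts|] := mmA s; first by left.
    by right; apply: AC_trans c1Z c2Z D12 _; rewrite inE sZ.
  by rewrite (negPf (cll s sc)).
have subZ : \bigcup_(s in c) strategy Z a s \subset Z.
  by apply/bigcupsP=> s /sP[].
split=> [s /sP[] //|]; rewrite inE subZ eqEsubset /=.
apply/andP; split; apply/subsetP=> s.
  by rewrite ![s \in must _ _]inE => /andP[/(subsetP subZ) -> ->].
rewrite -mustc ![s \in must _ _]inE => /andP[sc musts]; rewrite musts andbT.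
by apply/bigcupP; exists s => //; apply: must_state_loop musts (sP s sc).1.
Qed.

(** * The two language inclusions *)

Lemma vwaa_lang_sub w :
  vwaa_lang A w -> tgdra_lang (macro_tgdra A) w.
Proof.
case=> rho [runr accr]; have [_ rA rS] := runr.
(* [recurrent_set] is applied to visits and to absences at once, so that after
   [k] every must-state of [Z] has already been reached. *)
have [V [k [Vev Vinf]]] :=
  recurrent_set (fun (u : S * bool) i => (u.1 \in mdom (rho i)) == u.2).
pose Z := [set s | (s, true) \in V].
pose sigma i := (macro_run w i, w i, macro_run w i.+1).
have must_stay s i j : must_state A s -> i <= j ->
    s \in mdom (rho i) -> s \in mdom (rho j).
  move=> ms /subnK <-; elim: (j - i) => //= n IHn /IHn.
  by rewrite addSn -rS; apply: must_mem_range.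
have mdomZ i : k <= i -> mdom (rho i) \subset Z.
  move=> le_ki; apply/subsetP=> s si; rewrite inE.
  by apply: Vev le_ki _; rewrite si.
have Zinf s n : s \in Z -> exists2 i, n <= i & s \in mdom (rho i).
  by rewrite inE => /Vinf/(_ n)[i le_ni /eqP/= si]; exists i.
have ACZ i : k <= i -> mdom (rho i) \in AC A Z.
  move=> le_ki; rewrite inE mdomZ // eqEsubset /=; apply/andP; split.
    apply/subsetP=> s; rewrite ![s \in must _ _]inE.
    by case/andP=> /(subsetP (mdomZ _ le_ki)) ->.
  apply/subsetP=> s; rewrite ![s \in must _ _]inE => /andP[sZ ms].
  rewrite ms andbT; apply/idPn=> si.
  have [j _ sj] := Zinf s 0 sZ.
  (* An absence after [k] recurs, hence also after the visit at [j], contradicting [must_stay]. *)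
  have sV : (s, false) \in V by apply: Vev le_ki _; rewrite /= (negPf si).
  have [j' le_jj' /eqP/=] := Vinf _ sV j.
  by rewrite (must_stay s j j').
have kAT i : k <= i -> sigma i \in AT A Z.
  move=> le_ki; rewrite inE macro_run_trans /=; apply/exists_inP.
  exists (mdom (rho i)); first exact: ACZ.
  apply/exists_inP; exists (mdom (rho i.+1)).
    by rewrite in_setI ACZ ?(leqW le_ki) // andbT (run_mdom_macro i.+1 runr).
  by apply/DeltaP; exists (rho i); split=> //; exact: rA.
exists sigma; split; first exact/sa_run_macroP.
exists (GR A Z); first exact: imset_f.
split=> [|L /imsetP[f]].
  apply/Inf_t_avoidP; exists k => i /kAT siAT.
  by rewrite in_setD siAT.
rewrite inE => /andP[fF fZ] ->; apply/Inf_t_meetP=> n.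
(* If [ATf A Z f] were avoided from [n] on, then [f], once visited after both [n] and [k], would
   have to loop forever. *)
apply: NNPP => noL; apply: accr.
have [i0 le_ni0 fi0] := Zinf f (maxn n k) fZ.
have [le_n le_k] : n <= i0 /\ k <= i0 by apply/andP; rewrite -geq_max.
have loops i : i0 <= i -> f \in mdom (rho i) ->
    exists t, [/\ t \in rho i, src t = f & looping t].
  move=> le_i /mdomP[t tr tf]; exists t; split=> //.
  apply/idPn=> nloop; apply: noL; exists i; first exact: leq_trans le_i.
  have le_ki := leq_trans le_k le_i.
  rewrite in_set kAT //=; apply/existsP; exists (tgt t); apply/and3P; split.
  - by apply: multitransition_trans (rA i) _; exists t.
  - by rewrite -tf.
  by apply: subset_trans (mdomZ _ (leqW le_ki)); rewrite -rS;
    apply: bigcup_sup tr.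
exists i0, f; split=> // i le_i; apply: (loops) => //.
rewrite -(subnK le_i); elim: (i - i0) => //= m IHm.
have [||t [tr <- tl]] := loops (m + i0); rewrite ?leq_addl //.
by rewrite addSn -rS; apply/bigcupP; exists t.
Qed.

Lemma tgdra_lang_sub w :
  mmaa A -> tgdra_lang (macro_tgdra A) w -> vwaa_lang A w.
Proof.
move=> mmA [sigma [/sa_run_macroP sE [p /imsetP[Z _ ->] []]]].
case/Inf_t_avoidP=> k kK Linf.
have kAT i : k <= i -> exists c1 c2, [/\ c1 \in AC A Z, c2 \in AC A Z,
    (c1, w i, c2) \in Delta A & c2 \in macro_run w i.+1].
  move/kK; rewrite sE in_setD negb_and negbK macro_run_trans orbF.
  rewrite inE => /andP[_ /exists_inP[c1 c1Z /exists_inP[c2]]].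
  by rewrite in_setI => /andP[c2m c2Z] D12; exists c1, c2.
(* The start is the target [c0], at time [k.+1]: unlike [c1], it is known to lie in the macrostate,
   and as a range it contains no loopless state. *)
have [c1 [c0 [_ c0Z D0 c0m]]] := kAT k (leqnn k).
pose conf := fix conf i := if i is j.+1
  then \bigcup_(s in conf j) strategy Z (w (k.+1 + j)) s else c0.
pose rho i := choice_mt (conf i) (w (k.+1 + i)) (strategy Z (w (k.+1 + i))).
have Delta_i i : exists c1 c2,
    [/\ c1 \in AC A Z, c2 \in AC A Z & (c1, w (k.+1 + i), c2) \in Delta A].
  have [|d1 [d2 [d1Z d2Z D12 _]]] := kAT (k.+1 + i).
    by rewrite addSnnS leq_addr.
  by exists d1, d2.
have confP i : conf i \in AC A Z /\
    (forall s, s \in conf i -> ~~ loopless_state A s).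
  elim: i => [|i [IHZ IHl]].
    split=> //= s; have [T [mT _ <-]] := DeltaP _ _ _ D0.
    exact: mrange_not_loopless mT.
  have [sA sZ] := AC_strategy mmA (Delta_i i) IHZ IHl; split=> // s.
  rewrite /= -(choice_mt_range _ (w (k.+1 + i))).
  exact: mrange_not_loopless (choice_mtP sA).
have rhoA i : multitransition A (w (k.+1 + i)) (rho i).
  have [cZ cl] := confP i; apply: choice_mtP.
  exact: (AC_strategy mmA (Delta_i i) cZ cl).1.
have rhoS i : mrange (rho i) = mdom (rho i.+1).
  by rewrite choice_mt_range choice_mt_dom.
have [|rho' runr rE] := run_extend_left (n := k.+1) _ rhoA rhoS.
  by rewrite choice_mt_dom.
exists rho'; split=> // -[n [f [fF loops]]].
(* From time [k.+1] the only transition from [f] is the one of the strategy, so a looping one means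
   that the strategy keeps [f]. *)
have loop i : n <= k.+1 + i -> f \in strategy Z (w (k.+1 + i)) f /\ f \in Z.
  move/loops=> [t []]; rewrite rE => /imsetP[s sc ->] <- /= sl; split=> //.
  by have [] := confP i; rewrite inE => /andP[/subsetP cZ _] _; apply: cZ.
have fZ : f \in Z by case: (loop n); rewrite ?leq_addl.
have fL : ATf A Z f \in (GR A Z).2 by apply: imset_f; rewrite inE fF.
(* The bound puts [j] both in the strategy-driven part and among the indices where [f] loops, yet at
   [j] the strategy must leave [f]. *)
have [j le_j] := (Inf_t_meetP _ _).1 (Linf _ fL) (k.+1 + n).
rewrite sE inE => /andP[_ /= leaves].
have jE : k.+1 + (j - k.+1) = j.
  by rewrite subnKC // (leq_trans _ le_j) ?leq_addr.
have [] := loop (j - k.+1); rewrite jE ?(leq_trans _ le_j) ?leq_addl //.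
by rewrite (negPf (strategy_leaves leaves)).
Qed.

End Multitransitions.

Theorem theorem1 (AP S : finType) (A : vwaa S {set AP})
    (mmaaA : mmaa A) (finalA : final A = [set s | may_state A s]) :
  forall w : word {set AP}, tgdra_lang (macro_tgdra A) w <-> vwaa_lang A w.
Proof.
by move=> w; split; [apply: tgdra_lang_sub | apply: vwaa_lang_sub].
Qed.
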